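(* Every countable graph $G$ that contains no alternating ray admits an unfriendly partition, i.e. there is a map $c:V(G)\to\{0,1\}$ such that for every vertex $v\in V(G)$, $$|\{u\in N(v): c(u)\neq c(v)\}|\ \ge\ |\{u\in N(v): c(u)=c(v)\}|$$ (as cardinals).
   Context: Graphs are simple and undirected, possibly infinite; $N(v)$ denotes the neighborhood of $v$ and the degree of $v$ is the cardinality $|N(v)|$. A ray is a one-way infinite path $v_0v_1v_2\dots$ (distinct vertices, consecutive ones adjacent); it passes through the vertices $v_n$, $n\in\mathbb{N}$. A ray is alternating if it passes through infinitely many vertices of finite degree and through infinitely many vertices of infinite degree. *)

(* Defs.v *)
From Stdlib Require Import List.

Record simple_graph (V : Type) : Type := SimpleGraph {
  adj : V -> V -> Prop;
  adj_sym : forall u v, adj u v -> adj v u;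
  adj_irrefl : forall v, ~ adj v v
}.
Arguments adj {V} s _ _.

Definition countable_type (V : Type) : Prop :=
  exists f : V -> nat, forall x y, f x = f y -> x = y.

Definition finite_set {V : Type} (A : V -> Prop) : Prop :=
  exists l : list V, forall x, A x -> In x l.

Definition card_le {V : Type} (A B : V -> Prop) : Prop :=
  exists f : {x : V | A x} -> {y : V | B y},
    forall a b, f a = f b -> a = b.

Definition finite_degree {V : Type} (G : simple_graph V) (v : V) : Prop :=
  finite_set (fun u => adj G v u).

Definition is_ray {V : Type} (G : simple_graph V) (r : nat -> V) : Prop :=
  (forall m n, r m = r n -> m = n) /\ (forall n, adj G (r n) (r (S n))).

(* Infinitely many indices satisfy P. (Since a ray is injective, this is the
   same as infinitely many vertices of the ray.) *)
Definition infinitely_often (P : nat -> Prop) : Prop :=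
  forall N, exists n, N <= n /\ P n.

Definition alternating_ray {V : Type} (G : simple_graph V) (r : nat -> V) : Prop :=
  is_ray G r /\
  infinitely_often (fun n => finite_degree G (r n)) /\
  infinitely_often (fun n => ~ finite_degree G (r n)).

Definition unfriendly {V : Type} (G : simple_graph V) (c : V -> bool) : Prop :=
  forall v : V,
    card_le (fun u => adj G v u /\ c u = c v)
            (fun u => adj G v u /\ c u <> c v).

(* Main.v *)
(** Call a colouring minimal on a set of vertices of finite degree if no finite
    recolouring inside the set lowers the number of monochromatic edges; minimality forces
    majorities, and minimal colourings exist by compactness.  Call a set [U] extendable if
    every colouring outside [U] extends to [U] so that it is minimal on the vertices of finite
    degree in [U] and every vertex of infinite degree in [U] has infinitely many neighbours
    of the other colour.

    Extendability survives the addition of one vertex [x] of infinite degree: if [x] is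
    unhappy, flipping it costs only finitely much energy, so finitely many further changes
    restore minimality, and these disturb no vertex of infinite degree.  It also survives
    disjoint unions of pieces that send only finitely many edges to the rest: finitely many
    boundary traces allow the changes inside each piece to be confined to a finite set.

    Hence, if [U] is not hereditarily extendable, some vertex of infinite degree in [U] is
    wild, i.e. lies in no hereditarily extendable piece with a finite cut in [U].  Deleting
    the vertices of a path from a wild vertex to the next one keeps the latter wild, which
    yields a ray through infinitely many vertices of infinite degree.

    To make this ray alternating, edges between vertices of infinite degree are discarded
    first, except for a forest without rays that keeps the infinite degrees infinite; the
    vertices for which this is impossible have infinitely many neighbours among themselves
    and can be coloured in advance. *)

From Stdlib Require Import Arith Lia ZArith Cantor Bool List.
From Stdlib Require Import Classical ClassicalEpsilon.
Require Import Defs.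

(** * Bounded sets of natural numbers *)

Definition bounded (A : nat -> Prop) : Prop := exists N, forall x, A x -> x < N.

Lemma bounded_sub (A B : nat -> Prop) :
  bounded B -> (forall x, A x -> B x) -> bounded A.
Proof. intros [N HN] H. exists N. auto. Qed.

Lemma bounded_or (A B : nat -> Prop) :
  bounded A -> bounded B -> bounded (fun x => A x \/ B x).
Proof.
  intros [N HN] [M HM]. exists (N + M). intros x [H|H].
  - specialize (HN x H). lia.
  - specialize (HM x H). lia.
Qed.

Lemma uniform_below (P : nat -> nat -> Prop) (n : nat) :
  (forall i N N', N <= N' -> P i N -> P i N') ->
  (forall i, i < n -> exists N, P i N) ->
  exists N, forall i, i < n -> P i N.
Proof.
  intros Hmon. induction n as [|n IH]; intros H.
  - exists 0. lia.
  - destruct IH as [N HN]; [intros; apply H; lia|].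
    destruct (H n) as [M HM]; [lia|].
    exists (N + M). intros i Hi.
    destruct (Nat.eq_dec i n) as [->|Hne].
    + apply Hmon with M; [lia|easy].
    + apply Hmon with N; [lia|]. apply HN. lia.
Qed.

Lemma uniform_bounded (A : nat -> Prop) (P : nat -> nat -> Prop) :
  bounded A ->
  (forall i N N', N <= N' -> P i N -> P i N') ->
  (forall i, A i -> exists N, P i N) ->
  exists N, forall i, A i -> P i N.
Proof.
  intros [n Hn] Hmon H.
  destruct (uniform_below (fun i N => A i -> P i N) n) as [N HN].
  - intros i N N' Hle HP Ha. eauto.
  - intros i _. destruct (classic (A i)) as [Ha|Ha].
    + destruct (H i Ha) as [N HN]. eauto.
    + exists 0. tauto.
  - exists N. auto.
Qed.

Lemma unbounded_ge (A : nat -> Prop) :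
  ~ bounded A -> forall n, exists x, n <= x /\ A x.
Proof.
  intros HA n. apply NNPP. intros H. apply HA. exists n. intros x Hx.
  destruct (le_lt_dec n x); [|easy]. exfalso. eauto.
Qed.

(** * Dependent choice and compactness *)

Lemma dependent_choice (T : Type) (P : nat -> T -> Prop) (R : T -> T -> Prop) (t0 : T) :
  P 0 t0 ->
  (forall n t, P n t -> exists t', P (S n) t' /\ R t t') ->
  exists f : nat -> T, f 0 = t0 /\ (forall n, P n (f n)) /\ forall n, R (f n) (f (S n)).
Proof.
  intros H0 Hs.
  assert (Hs' : forall n (t : {t | P n t}), {t' : {t | P (S n) t} | R (proj1_sig t) (proj1_sig t')}).
  { intros n [t Ht]. apply constructive_indefinite_description.
    destruct (Hs n t Ht) as [t' [H1 H2]]. exists (exist _ t' H1). easy. }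
  set (g := fix g n : {t | P n t} :=
        match n with 0 => exist _ t0 H0 | S n => proj1_sig (Hs' n (g n)) end).
  exists (fun n => proj1_sig (g n)). split; [easy|]. split.
  - intros n. apply proj2_sig.
  - intros n. simpl. apply (proj2_sig (Hs' n (g n))).
Qed.

Lemma functional_choice (A B : Type) (P : A -> B -> Prop) :
  (forall a, exists b, P a b) -> exists f : A -> B, forall a, P a (f a).
Proof.
  intros H. exists (fun a => proj1_sig (constructive_indefinite_description _ (H a))).
  intros a. apply proj2_sig.
Qed.

Definition dec (P : Prop) : bool := if excluded_middle_informative P then true else false.

Lemma dec_true (P : Prop) : P -> dec P = true.
Proof. unfold dec. destruct (excluded_middle_informative P); tauto. Qed.

Lemma dec_false (P : Prop) : ~ P -> dec P = false.
Proof. unfold dec. destruct (excluded_middle_informative P); tauto. Qed.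

Definition update (c : nat -> bool) (x : nat) (b : bool) : nat -> bool :=
  fun y => if Nat.eq_dec y x then b else c y.

(** A prefix of length [N] is kept while infinitely many [cs n] share it; at least one of its two
    one-step extensions then has the same property. *)
Lemma coloring_compactness (cs : nat -> nat -> bool) :
  exists c : nat -> bool,
    forall N n0, exists n, n0 <= n /\ forall x, x < N -> cs n x = c x.
Proof.
  set (P := fun N c => forall n0, exists n, n0 <= n /\ forall x, x < N -> cs n x = c x).
  destruct (dependent_choice (nat * (nat -> bool)) (fun N t => fst t = N /\ P N (snd t))
             (fun t t' => forall x, x < fst t -> snd t' x = snd t x) (0, fun _ => true))
    as [f [_ [Hf1 Hf2]]].
  - split; [easy|]. intros n0. exists n0. split; [lia|]. lia.
  - intros N [N' c] [HN HP]. simpl in *. subst N'.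
    assert (Hb : exists b, P (S N) (update c N b)).
    { apply NNPP. intros H.
      assert (Hn : forall b, exists n0, forall n, n0 <= n -> (forall x, x < N -> cs n x = c x) -> cs n N <> b).
      { intros b. apply NNPP. intros Hb. apply H. exists b. intros n0. apply NNPP. intros Hc.
        apply Hb. exists n0. intros n Hn Hx Hbn. apply Hc. exists n. split; [easy|].
        intros x Hxn. unfold update. destruct (Nat.eq_dec x N) as [->|Hne]; [easy|].
        apply Hx. lia. }
      destruct (Hn true) as [n1 H1]. destruct (Hn false) as [n2 H2].
      destruct (HP (n1 + n2)) as [n [Hle Hx]].
      specialize (H1 n ltac:(lia) Hx). specialize (H2 n ltac:(lia) Hx).
      destruct (cs n N); congruence. }
    destruct Hb as [b Hb]. exists (S N, update c N b). simpl. repeat split; auto.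
    intros x Hx. unfold update. destruct (Nat.eq_dec x N); [lia|easy].
  - assert (Hag : forall N M x, x < N -> N <= M -> snd (f M) x = snd (f N) x).
    { intros N M x Hx Hle. induction Hle as [|M Hle IH]; [easy|].
      rewrite <- IH. apply Hf2. rewrite (proj1 (Hf1 M)). lia. }
    exists (fun x => snd (f (S x)) x). intros N n0.
    destruct (proj2 (Hf1 N) n0) as [n [Hn Hx]]. exists n. split; [easy|].
    intros x HxN. rewrite (Hx x HxN). apply Hag; lia.
Qed.

(* Only finitely many traces [t] restricted to [0, K) exist. *)
Lemma uniform_trace (K : nat) (P : (nat -> bool) -> nat -> Prop) :
  (forall t N N', N <= N' -> P t N -> P t N') ->
  (forall t t' N, (forall x, x < K -> t x = t' x) -> P t N -> P t' N) ->
  (forall t, exists N, P t N) ->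
  exists N, forall t, P t N.
Proof.
  revert P. induction K as [|K IH]; intros P Hmon Hdep Hex.
  - destruct (Hex (fun _ => true)) as [N HN]. exists N. intros t.
    apply (Hdep (fun _ => true)); [lia|easy].
  - assert (H : forall b, exists N, forall t, P (update t K b) N).
    { intros b. apply (IH (fun t N => P (update t K b) N)).
      - intros t N N'. apply Hmon.
      - intros t t' N Ht. apply Hdep. intros x Hx. unfold update.
        destruct (Nat.eq_dec x K); [easy|]. apply Ht. lia.
      - intros t. apply Hex. }
    destruct (H true) as [N1 H1]. destruct (H false) as [N2 H2].
    exists (N1 + N2). intros t.
    apply (Hdep (update t K (t K))).
    + intros x _. unfold update. destruct (Nat.eq_dec x K) as [->|]; easy.
    + destruct (t K).
      * apply Hmon with N1; [lia|apply H1].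
      * apply Hmon with N2; [lia|apply H2].
Qed.

Lemma Z_least (P : Z -> Prop) (B : Z) :
  (exists k, P k) -> (forall k, P k -> (B <= k)%Z) ->
  exists k, P k /\ forall k', P k' -> (k <= k')%Z.
Proof.
  intros [k Hk] HB.
  remember (Z.to_nat (k - B)) as n eqn:Hn. revert k Hk Hn.
  induction n as [n IH] using lt_wf_ind. intros k Hk Hn.
  destruct (classic (exists k', P k' /\ (k' < k)%Z)) as [[k' [H1 H2]]|H].
  - apply (IH (Z.to_nat (k' - B))) with k'; auto.
    specialize (HB k' H1). lia.
  - exists k. split; [easy|]. intros k' Hk'.
    destruct (Z_le_gt_dec k k'); [easy|]. exfalso. apply H. exists k'. split; [easy|lia].
Qed.

(** * Injections between sets of natural numbers *)

Definition injects (A B : nat -> Prop) : Prop :=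
  exists g : nat -> nat, (forall x, A x -> B (g x)) /\
    forall x y, A x -> A y -> g x = g y -> x = y.

Lemma injects_unbounded (A B : nat -> Prop) : ~ bounded B -> injects A B.
Proof.
  intros HB. destruct (unbounded_ge B HB 0) as [b0 [_ Hb0]].
  destruct (dependent_choice nat (fun _ b => B b) lt b0 Hb0) as [g [_ [Hg1 Hg2]]].
  { intros n b _. destruct (unbounded_ge B HB (S b)) as [b' [H1 H2]]. exists b'. split; [easy|lia]. }
  exists g. split; [auto|].
  assert (Hmono : forall m n, m < n -> g m < g n).
  { intros m n H. induction H as [|n H IH]; [auto|]. specialize (Hg2 n). lia. }
  intros x y _ _ E. destruct (lt_eq_lt_dec x y) as [[H|H]|H]; [|easy|]; apply Hmono in H; lia.
Qed.

Lemma list_injection (la lb : list nat) :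
  NoDup la -> NoDup lb -> length la <= length lb ->
  exists g : nat -> nat, (forall x, In x la -> In (g x) lb) /\
    forall x y, In x la -> In y la -> g x = g y -> x = y.
Proof.
  revert lb. induction la as [|a la IH]; intros lb Ha Hb Hle.
  - exists (fun x => x). simpl. tauto.
  - destruct lb as [|b lb]; [simpl in Hle; lia|].
    inversion Ha as [|? ? Ha1 Ha2]; inversion Hb as [|? ? Hb1 Hb2]; subst.
    destruct (IH lb) as [g [Hg1 Hg2]]; [easy|easy|simpl in Hle; lia|].
    exists (fun x => if Nat.eq_dec x a then b else g x). split.
    + intros x Hx. destruct (Nat.eq_dec x a) as [->|Hne]; [now left|].
      right. apply Hg1. destruct Hx; [congruence|easy].
    + intros x y Hx Hy E.
      destruct (Nat.eq_dec x a) as [->|Hnx]; destruct (Nat.eq_dec y a) as [->|Hny]; auto.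
      * destruct Hb1. rewrite E. apply Hg1. destruct Hy; [congruence|easy].
      * destruct Hb1. rewrite <- E. apply Hg1. destruct Hx; [congruence|easy].
      * apply Hg2; auto; [destruct Hx|destruct Hy]; congruence || easy.
Qed.

Fixpoint sum (f : nat -> Z) (n : nat) : Z :=
  match n with 0 => 0 | S n => sum f n + f n end.

(** The sum is the number of [b] minus the number of [a] below [N]. This is how a nonnegative energy
    change becomes an injection. *)
Lemma injects_of_sum (a b : nat -> Prop) (N : nat) :
  (0 <= sum (fun p => (if dec (b p) then 1 else 0) - (if dec (a p) then 1 else 0))%Z N)%Z ->
  exists g : nat -> nat, (forall p, a p -> p < N -> b (g p)) /\
    forall p q, a p -> p < N -> a q -> q < N -> g p = g q -> p = q.
Proof.
  set (l := fun (P : nat -> Prop) n => filter (fun p => dec (P p)) (seq 0 n)).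
  assert (Hlen : forall n,
    sum (fun p => (if dec (b p) then 1 else 0) - (if dec (a p) then 1 else 0))%Z n =
    (Z.of_nat (length (l b n)) - Z.of_nat (length (l a n)))%Z).
  { induction n as [|n IH]; [easy|]. cbn [sum]. rewrite IH. unfold l.
    rewrite seq_S, !filter_app, !length_app. simpl.
    destruct (dec (a n)), (dec (b n)); simpl; lia. }
  intros H. rewrite Hlen in H.
  assert (Hin : forall P n p, In p (l P n) <-> P p /\ p < n).
  { intros P n p. unfold l. rewrite filter_In, in_seq.
    destruct (classic (P p)) as [Hp|Hp].
    - rewrite (dec_true _ Hp). split; [intros [? _]; split; [easy|lia]|intros [_ ?]; split; [lia|easy]].
    - rewrite (dec_false _ Hp). split; [easy|tauto]. }
  destruct (list_injection (l a N) (l b N)) as [g [Hg1 Hg2]].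
  - apply NoDup_filter, seq_NoDup.
  - apply NoDup_filter, seq_NoDup.
  - lia.
  - exists g. split.
    + intros p Hp Hlt. apply (Hin b N). apply Hg1. apply Hin. easy.
    + intros p q Hp Hp' Hq Hq'. apply Hg2; apply Hin; easy.
Qed.

(** * Energy of a colouring *)

Definition same (c : nat -> bool) (u v : nat) : Z := if eqb (c u) (c v) then 1 else 0.

Lemma same_ext (c c' : nat -> bool) (u v : nat) :
  c u = c' u -> c v = c' v -> same c u v = same c' u v.
Proof. unfold same. intros -> ->. easy. Qed.

Lemma same_sym (c : nat -> bool) (u v : nat) : same c u v = same c v u.
Proof. unfold same. destruct (c u), (c v); easy. Qed.

Section Graph.
Context (adj : nat -> nat -> Prop) (adj_sym : forall u v, adj u v -> adj v u).

Definition fin_deg (x : nat) : Prop := bounded (adj x).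

(** Edges are indexed by Cantor codes of pairs; the test [u < v] counts each undirected edge
    once. *)
Definition edge_energy (c : nat -> bool) (p : nat) : Z :=
  let (u, v) := of_nat p in if dec (adj u v /\ u < v) then same c u v else 0.

Definition energy (c : nat -> bool) (N : nat) : Z := sum (edge_energy c) N.

(* The total energy of a colouring may be infinite, but the energy difference of two
   colourings that disagree on the monochromaticity of finitely many edges is not. *)
Definition gain (c c' : nat -> bool) (k : Z) : Prop :=
  exists N0, forall N, N0 <= N -> (energy c' N - energy c N = k)%Z.

Lemma gain_refl c : gain c c 0.
Proof. exists 0. intros. lia. Qed.

Lemma gain_sym c c' k : gain c c' k -> gain c' c (- k).
Proof. intros [N H]. exists N. intros M HM. specialize (H M HM). lia. Qed.

Lemma gain_trans c c' c'' k k' : gain c c' k -> gain c' c'' k' -> gain c c'' (k + k').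
Proof.
  intros [N H] [N' H']. exists (N + N'). intros M HM.
  specialize (H M ltac:(lia)). specialize (H' M ltac:(lia)). lia.
Qed.

Lemma code_bound (K : nat) :
  exists B, forall p u v, of_nat p = (u, v) -> B <= p -> K <= u \/ K <= v.
Proof.
  destruct (uniform_below (fun u N => forall v, v < K -> to_nat (u, v) < N) K) as [B HB].
  - intros i N N' Hle H v Hv. specialize (H v Hv). lia.
  - intros u _. destruct (uniform_below (fun v N => to_nat (u, v) < N) K) as [N HN].
    + intros; lia.
    + intros v _. exists (S (to_nat (u, v))). lia.
    + eauto.
  - exists B. intros p u v Hp Hle.
    destruct (le_lt_dec K u); [tauto|]. destruct (le_lt_dec K v); [tauto|].
    specialize (HB u l v l0). rewrite <- Hp, cancel_to_of in HB. lia.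
Qed.

Lemma edge_energy_range c p : (0 <= edge_energy c p <= 1)%Z.
Proof.
  unfold edge_energy, same. destruct (of_nat p) as [u v].
  destruct (dec (adj u v /\ u < v)); destruct (eqb (c u) (c v)); lia.
Qed.

(* The finitely many edges inside [0, K) are paid for by the constant [B]. *)
Lemma gain_compare (K : nat) :
  exists B, forall c1 c1' c2 c2' k1 k2,
    gain c1 c1' k1 -> gain c2 c2' k2 ->
    (forall u v, adj u v -> K <= u \/ K <= v ->
       (same c2' u v - same c2 u v <= same c1' u v - same c1 u v)%Z) ->
    (k2 - B <= k1)%Z.
Proof.
  (* Each of the [B] codes moves either energy difference by at most 1 in absolute value, hence the
     factor 2. *)
  destruct (code_bound K) as [B HB]. exists (2 * Z.of_nat B)%Z.
  intros c1 c1' c2 c2' k1 k2 [N1 H1] [N2 H2] H.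
  specialize (H1 (N1 + N2) ltac:(lia)). specialize (H2 (N1 + N2) ltac:(lia)).
  rewrite <- H1, <- H2. generalize (N1 + N2). clear - H HB.
  assert (Hm : forall m,
    (energy c2' m - energy c2 m - 2 * Z.of_nat (min m B) <= energy c1' m - energy c1 m)%Z).
  { induction m as [|m IH]; [simpl; lia|].
    unfold energy in *. cbn [sum].
    destruct (le_lt_dec B m) as [Hle|Hlt].
    - assert (He : (edge_energy c2' m - edge_energy c2 m <= edge_energy c1' m - edge_energy c1 m)%Z).
      { unfold edge_energy. destruct (of_nat m) as [u v] eqn:Hp.
        unfold dec. destruct (excluded_middle_informative _) as [[Ha _]|_]; [|lia].
        apply H; eauto. }
      lia.
    - pose proof (edge_energy_range c1 m). pose proof (edge_energy_range c1' m).
      pose proof (edge_energy_range c2 m). pose proof (edge_energy_range c2' m). lia. }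
  intros m. specialize (Hm m). lia.
Qed.

Lemma gain_transfer c1 c1' c2 c2' k :
  (forall u v, adj u v ->
     (same c2' u v - same c2 u v = same c1' u v - same c1 u v)%Z) ->
  gain c1 c1' k -> gain c2 c2' k.
Proof.
  intros H [N HN]. exists N. intros m Hm. rewrite <- (HN m Hm). clear - H.
  induction m as [|m IH]; [easy|]. unfold energy in *. cbn [sum].
  assert (He : (edge_energy c2' m - edge_energy c2 m = edge_energy c1' m - edge_energy c1 m)%Z).
  { unfold edge_energy. destruct (of_nat m) as [u v].
    unfold dec. destruct (excluded_middle_informative _) as [[Ha _]|_]; [|lia].
    apply H; eauto. }
  lia.
Qed.

Lemma gain_exists c c' K :
  (forall u v, adj u v -> K <= u \/ K <= v -> same c' u v = same c u v) ->
  exists k, gain c c' k.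
Proof.
  intros H. destruct (code_bound K) as [B HB].
  exists (energy c' B - energy c B)%Z. exists B. intros N HN.
  induction HN as [|N HN IH]; [easy|]. rewrite <- IH. unfold energy. cbn [sum].
  assert (He : edge_energy c' N = edge_energy c N).
  { unfold edge_energy. destruct (of_nat N) as [u v] eqn:Hp.
    unfold dec. destruct (excluded_middle_informative _) as [[Ha _]|_]; [|easy].
    apply H; eauto. }
  lia.
Qed.

(** * Minimal colourings *)

Definition modif (A : nat -> Prop) (c c' : nat -> bool) : Prop :=
  (forall x, ~ A x -> c' x = c x) /\ bounded (fun x => c' x <> c x).

(** Only recolourings with a well-defined energy change are tested; if all vertices of [A] have
    finite degree, every finite recolouring inside [A] has one. *)
Definition minimal (A : nat -> Prop) (c : nat -> bool) : Prop :=
  forall c' k, modif A c c' -> gain c c' k -> (0 <= k)%Z.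

Lemma modif_trans A c c' c'' : modif A c c' -> modif A c' c'' -> modif A c c''.
Proof.
  intros [H1 B1] [H2 B2]. split.
  - intros x Hx. rewrite H2, H1; easy.
  - apply (bounded_sub _ _ (bounded_or _ _ B1 B2)). intros x Hx.
    destruct (bool_dec (c' x) (c x)); [right|left]; congruence.
Qed.

Lemma modif_refl A c : modif A c c.
Proof. split; [easy|]. exists 0. intros x H. congruence. Qed.

Lemma neighbourhood_bound (D : nat -> Prop) :
  bounded D -> (forall x, D x -> fin_deg x) ->
  exists K, forall x, D x -> x < K /\ forall y, adj x y -> y < K.
Proof.
  intros HD HF. apply (uniform_bounded D (fun x K => x < K /\ forall y, adj x y -> y < K)); auto.
  - intros x N N' Hle [H1 H2]. split; [lia|]. intros y Hy. specialize (H2 y Hy). lia.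
  - intros x Hx. destruct (HF x Hx) as [N HN]. exists (N + S x). split; [lia|].
    intros y Hy. specialize (HN y Hy). lia.
Qed.

Lemma modif_gain A c c' :
  (forall x, A x -> fin_deg x) -> modif A c c' -> exists k, gain c c' k.
Proof.
  intros HF [H1 H2].
  destruct (neighbourhood_bound _ H2) as [K HK].
  { intros x Hx. apply HF. apply NNPP. intros Hn. auto. }
  apply gain_exists with K. intros u v Huv Hge. apply same_ext.
  - apply NNPP. intros Hn. destruct (HK u Hn) as [Ha Hb]. specialize (Hb v Huv). lia.
  - apply NNPP. intros Hn. destruct (HK v Hn) as [Ha Hb]. specialize (Hb u (adj_sym _ _ Huv)). lia.
Qed.

Lemma minimal_attained A c B :
  (forall c' k, modif A c c' -> gain c c' k -> (B <= k)%Z) ->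
  exists c', modif A c c' /\ minimal A c'.
Proof.
  intros H.
  destruct (Z_least (fun k => exists c', modif A c c' /\ gain c c' k) B) as [k [[c' [Hm Hg]] Hmin]].
  - exists 0%Z, c. split; [apply modif_refl|apply gain_refl].
  - intros k [c' [H1 H2]]. eauto.
  - exists c'. split; [easy|]. intros c'' j Hm' Hg'.
    assert (k <= k + j)%Z; [|lia].
    apply Hmin. exists c''. split; [eapply modif_trans|eapply gain_trans]; eauto.
Qed.

(** Minimise on the finite truncations of [A] and take a cluster point. A finite improvement of the
    limit involves finitely many edges, so it would already improve some truncated minimiser. *)
Lemma minimal_exists A c0 :
  (forall x, A x -> fin_deg x) ->
  exists c, (forall x, ~ A x -> c x = c0 x) /\ minimal A c.
Proof.
  intros HF.
  assert (Hn : forall n, exists c, modif (fun x => A x /\ x < n) c0 c /\ minimal (fun x => A x /\ x < n) c).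
  { intros n. destruct (neighbourhood_bound (fun x => A x /\ x < n)) as [K HK].
    - exists n. tauto.
    - intros x [Hx _]. auto.
    - destruct (gain_compare K) as [B HB]. apply minimal_attained with (0 - B)%Z.
      intros c' k [Hm _] Hg. apply (HB c0 c' c0 c0 k 0%Z Hg (gain_refl c0)).
      intros u v Huv Hge.
      rewrite (same_ext c' c0 u v); [lia| |].
      + apply Hm. intros Hn. destruct (HK u Hn) as [Ha Hb]. specialize (Hb v Huv). lia.
      + apply Hm. intros Hn. destruct (HK v Hn) as [Ha Hb]. specialize (Hb u (adj_sym _ _ Huv)). lia. }
  destruct (functional_choice _ _ _ Hn) as [cs Hcs].
  destruct (coloring_compactness cs) as [c Hc].
  exists c. split.
  - intros x Hx. destruct (Hc (S x) 0) as [n [_ Hn']]. rewrite <- Hn' by lia.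
    destruct (Hcs n) as [[H _] _]. apply H. tauto.
  - intros c' k [Hm1 Hm2] Hg.
    destruct (neighbourhood_bound _ Hm2) as [K HK].
    { intros x Hx. apply HF. apply NNPP. intros Hn'. auto. }
    destruct (Hc K K) as [n [Hle Hn']].
    (* [d] transplants the change from [c] to [c'] onto [cs n]. Since [cs n] and [c] agree below
       [K], where all affected edges lie, the energy change is the same. *)
    set (d := fun x => if bool_dec (c' x) (c x) then cs n x else c' x).
    assert (Hd : forall x, d x <> cs n x -> c' x <> c x).
    { intros x Hx E. apply Hx. unfold d. destruct (bool_dec _ _); easy. }
    assert (Hd' : forall x, x < K -> d x = c' x).
    { intros x Hx. unfold d. destruct (bool_dec _ _); [|easy]. rewrite Hn'; congruence. }
    apply (proj2 (Hcs n) d k).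
    + split.
      * intros x Hx. apply NNPP. intros Hn2. apply Hx. pose proof (Hd x Hn2) as Hn3. split.
        -- apply NNPP. intros Hn4. auto.
        -- destruct (HK x Hn3). lia.
      * apply (bounded_sub _ _ Hm2). auto.
    + apply (gain_transfer c c'); [|easy]. intros u v Huv.
      destruct (classic ((c' u <> c u) \/ (c' v <> c v))) as [Hch|Hch].
      * assert (Hlt : u < K /\ v < K).
        { destruct Hch as [Hch|Hch]; destruct (HK _ Hch) as [Ha Hb]; split; auto. }
        rewrite (same_ext d c'), (same_ext (cs n) c); try lia; try apply Hn'; try apply Hd'; lia.
      * rewrite (same_ext c' c), (same_ext d (cs n)); try lia.
        -- apply NNPP. intros H. apply Hd in H. tauto.
        -- apply NNPP. intros H. apply Hd in H. tauto.
        -- apply NNPP. tauto.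
        -- apply NNPP. tauto.
Qed.

(** * Extendable sets *)

(** In a countable graph, infinitely many neighbours of the other colour already form a majority at
    a vertex of infinite degree. *)
Definition happy (c : nat -> bool) (x : nat) : Prop :=
  ~ bounded (fun y => adj x y /\ c y <> c x).

Definition extendable (U : nat -> Prop) : Prop :=
  forall c0, exists c, (forall x, ~ U x -> c x = c0 x) /\
    minimal (fun x => U x /\ fin_deg x) c /\
    forall x, U x -> ~ fin_deg x -> happy c x.

Lemma happy_change c c' x :
  happy c x -> c' x = c x -> bounded (fun y => adj x y /\ c' y <> c y) -> happy c' x.
Proof.
  intros Hh Hx Hb Hn. apply Hh. apply (bounded_sub _ _ (bounded_or _ _ Hb Hn)).
  intros y [Hy1 Hy2]. rewrite Hx. destruct (bool_dec (c' y) (c y)) as [E|E].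
  - right. rewrite E. easy.
  - left. easy.
Qed.

Lemma minimal_sub A A' c : (forall x, A' x -> A x) -> minimal A c -> minimal A' c.
Proof.
  intros H Hm c' k [H1 H2]. apply Hm. split; [|easy]. intros x Hx. apply H1. auto.
Qed.

Lemma extendable_ext U U' : (forall x, U x <-> U' x) -> extendable U -> extendable U'.
Proof.
  intros HU H c0. destruct (H c0) as [c [H1 [H2 H3]]]. exists c. split; [|split].
  - intros x Hx. apply H1. rewrite HU. easy.
  - revert H2. apply minimal_sub. intros x. rewrite HU. easy.
  - intros x Hx. apply H3. apply HU. easy.
Qed.

Lemma extendable_fin_deg U : (forall x, U x -> fin_deg x) -> extendable U.
Proof.
  intros H c0. destruct (minimal_exists U c0 H) as [c [H1 H2]]. exists c. split; [easy|]. split.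
  - revert H2. apply minimal_sub. tauto.
  - intros x Hx Hn. destruct (Hn (H x Hx)).
Qed.

Lemma extendable_add U x :
  ~ fin_deg x -> extendable U -> extendable (fun y => U y \/ y = x).
Proof.
  intros Hinf HU. destruct (classic (U x)) as [Hx|Hx].
  { apply (extendable_ext U); [|easy]. intros y. split; [tauto|]. intros [H|H]; [easy|]. subst y. easy. }
  intros c0. destruct (HU c0) as [c [H1 [H2 H3]]].
  assert (H2' : minimal (fun y => (U y \/ y = x) /\ fin_deg y) c).
  { revert H2. apply minimal_sub. intros y [[Hy|Hy] Hd]; [easy|]. subst y. contradiction. }
  destruct (classic (happy c x)) as [Hh|Hh].
  { exists c. split; [|split; [easy|]].
    - intros y Hy. apply H1. tauto.
    - intros y [Hy|Hy] Hd; [auto|]. subst y. easy. }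
  apply NNPP in Hh.
  set (c1 := update c x (negb (c x))).
  assert (Hc1x : c1 x = negb (c x)) by (unfold c1, update; destruct (Nat.eq_dec x x); easy).
  assert (Hc1 : forall y, y <> x -> c1 y = c y)
    by (intros y Hy; unfold c1, update; destruct (Nat.eq_dec y x); easy).
  set (A := fun y => (U y \/ y = x) /\ fin_deg y) in *.
  assert (HAx : ~ A x) by (unfold A; tauto).
  destruct Hh as [K HK].
  destruct (gain_compare (K + S x)) as [B HB].
  destruct (minimal_attained A c1 (0 - B)%Z) as [c2 [Hm2 Hmin2]].
  { intros c1' k [Hm Hb] Hg.
    (* Giving [x] its old colour back yields a finite recolouring of [c] inside [A], to which the
       minimality of [c] applies. *)
    set (c' := update c1' x (c x)).
    assert (Hc'x : c' x = c x) by (unfold c', update; destruct (Nat.eq_dec x x); easy).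
    assert (Hc' : forall y, y <> x -> c' y = c1' y)
      by (intros y Hy; unfold c', update; destruct (Nat.eq_dec y x); easy).
    assert (Hmc : modif A c c').
    { split.
      - intros y Hy. destruct (Nat.eq_dec y x) as [->|Hne]; [easy|].
        rewrite Hc', Hm, Hc1; easy.
      - apply (bounded_sub _ _ Hb). intros y Hy.
        destruct (Nat.eq_dec y x) as [->|Hne]; [congruence|].
        rewrite <- Hc', Hc1; easy. }
    destruct (modif_gain A c c' ltac:(unfold A; tauto) Hmc) as [k' Hk'].
    pose proof (H2' c' k' Hmc Hk') as Hpos.
    assert (k' - B <= k)%Z; [|lia].
    apply (HB c1 c1' c c' k k' Hg Hk').
    (* Flipping [x] reverses the sign of the change at an edge [x y]; this is harmful only
       when [y] had the colour opposite to [x], which happens finitely often. *)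
    assert (Hxv : forall v, adj x v -> K <= v -> v <> x ->
      (same c' x v - same c x v <= same c1' x v - same c1 x v)%Z).
    { intros v Hv Hge Hne. unfold same. rewrite Hc'x, (Hm x HAx), Hc1x, (Hc' v Hne), (Hc1 v Hne).
      assert (Hcv : c v = c x).
      { apply NNPP. intros Hn. specialize (HK v (conj Hv Hn)). lia. }
      rewrite Hcv. destruct (c x), (c1' v); simpl; lia. }
    intros u v Huv Hge.
    destruct (Nat.eq_dec u x) as [->|Hu]; destruct (Nat.eq_dec v x) as [->|Hv].
    - lia.
    - apply Hxv; [easy|lia|easy].
    - rewrite !(same_sym _ u x). apply Hxv; [auto|lia|easy].
    - rewrite (same_ext c' c1'), (same_ext c c1) by (rewrite ?Hc', ?Hc1; easy). lia. }
  destruct Hm2 as [Hm2 Hb2].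
  exists c2. split; [|split; [easy|]].
  - intros y Hy. rewrite Hm2 by (unfold A; tauto). rewrite Hc1 by tauto. apply H1. tauto.
  - intros y Hy Hd. apply (happy_change c1).
    + destruct (Nat.eq_dec y x) as [->|Hne].
      (* If [x] were unhappy with both colours, its neighbourhood would be a union of two bounded
         sets, up to [x] itself. *)
      * intros Hb. apply Hinf.
        assert (HK' : bounded (fun y => adj x y /\ c y <> c x)) by (exists K; easy).
        assert (HS : bounded (fun y => y = x)) by (exists (S x); intros; lia).
        apply (bounded_sub _ _ (bounded_or _ _ HS (bounded_or _ _ HK' Hb))).
        intros y Hy'. destruct (Nat.eq_dec y x) as [->|Hne]; [tauto|]. right.
        rewrite Hc1x, (Hc1 y Hne).
        destruct (bool_dec (c y) (c x)) as [E|E]; [right|left]; split; auto.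
        rewrite E. destruct (c x); easy.
      * apply (happy_change c).
        -- apply H3; [|easy]. destruct Hy; congruence.
        -- auto.
        -- exists (S x). intros z [_ Hz]. destruct (Nat.eq_dec z x); [lia|].
           destruct Hz. auto.
    + apply Hm2. unfold A. tauto.
    + apply (bounded_sub _ _ Hb2). tauto.
Qed.

(** A recolouring inside [A] affects only edges that meet [A], so the colours elsewhere do not enter
    the energy change. *)
Lemma minimal_transfer A c1 c2 :
  (forall x y, A x -> adj x y -> c1 x = c2 x /\ c1 y = c2 y) ->
  minimal A c1 -> minimal A c2.
Proof.
  intros Hag Hmin c2' k [Hm Hb] Hg.
  set (c1' := fun x => if bool_dec (c2' x) (c2 x) then c1 x else c2' x).
  assert (Hch : forall x, c2' x <> c2 x -> A x).
  { intros x Hx. apply NNPP. intros Hn. auto. }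
  assert (Heq : forall x, c2' x = c2 x -> c1' x = c1 x).
  { intros x Hx. unfold c1'. destruct (bool_dec _ _); easy. }
  apply (Hmin c1' k).
  - split.
    + intros x Hx. auto.
    + apply (bounded_sub _ _ Hb). intros x Hx E. auto.
  - apply (gain_transfer c2 c2'); [|easy]. intros u v Huv.
    assert (Hs : forall x, c1 x = c2 x -> c1' x = c2' x).
    { intros x Hx. unfold c1'. destruct (bool_dec (c2' x) (c2 x)); congruence. }
    destruct (classic (c2' u = c2 u /\ c2' v = c2 v)) as [[E1 E2]|E].
    + rewrite (same_ext c1' c1), (same_ext c2' c2) by auto. lia.
    + assert (Huv' : c1 u = c2 u /\ c1 v = c2 v).
      { apply not_and_or in E. destruct E as [E|E].
        - apply Hag; auto.
        - apply and_comm. apply Hag; auto. }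
      destruct Huv' as [Hu Hv].
      rewrite (same_ext c1' c2'), (same_ext c1 c2) by auto. lia.
Qed.

(* [N] does not depend on the colouring [t] around [Q], since [Q] sees only finitely many
   vertices of [U] outside [Q]. *)
Lemma minimal_repair (U Q : nat -> Prop) (c0 r : nat -> bool) (K : nat) :
  (forall x, ~ Q x -> r x = c0 x) ->
  minimal (fun x => Q x /\ fin_deg x) r ->
  (forall x y, Q x -> U y -> ~ Q y -> adj x y -> x < K /\ y < K) ->
  exists N, forall t, (forall x, ~ U x -> t x = c0 x) ->
    exists d, (forall x, ~ Q x -> d x = t x) /\
      (forall x, Q x -> ~ fin_deg x \/ N <= x -> d x = r x) /\
      minimal (fun x => Q x /\ fin_deg x) d.
Proof.
  intros Hr Hmin HK.
  set (A := fun x => Q x /\ fin_deg x) in *.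
  (* Forcing [c0] outside [U] lets an arbitrary [t] serve as a trace, as [uniform_trace] demands. *)
  set (out := fun (t : nat -> bool) x => if dec (U x) then t x else c0 x).
  destruct (uniform_trace K (fun t N => exists d, (forall x, ~ Q x -> d x = out t x) /\
      (forall x, Q x -> ~ fin_deg x \/ N <= x -> d x = r x) /\ minimal A d)) as [N HN].
  - intros t N N' Hle [d [H1 [H2 H3]]]. exists d. split; [easy|]. split; [|easy].
    intros x Hx [H|H]; apply H2; auto. right. lia.
  (* A neighbour of [Q] outside [Q] either lies in [U], hence below [K], or has its colour fixed by
     [c0]. *)
  - intros t t' N Ht [d [H1 [H2 H3]]].
    exists (fun x => if dec (Q x) then d x else out t' x). split; [|split].
    + intros x Hx. rewrite (dec_false _ Hx). easy.
    + intros x Hx. rewrite (dec_true _ Hx). auto.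
    + revert H3. apply minimal_transfer. intros x y [Hx _] Hxy. rewrite (dec_true _ Hx).
      split; [easy|]. destruct (classic (Q y)) as [Hy|Hy].
      * rewrite (dec_true _ Hy). easy.
      * rewrite (dec_false _ Hy), (H1 y Hy). unfold out.
        destruct (classic (U y)) as [Hu|Hu].
        -- rewrite (dec_true _ Hu). apply Ht. apply (HK x y); easy.
        -- rewrite (dec_false _ Hu). easy.
  (* [ct] is [r] on [Q] and the trace outside. Recolouring inside [Q] costs the same from [ct] as
     from the minimal [r], except at edges inside [0, [K]), so the energy is bounded below. *)
  - intros t. set (ct := fun x => if dec (Q x) then r x else out t x).
    assert (HctQ : forall x, Q x -> ct x = r x)
      by (intros x Hx; unfold ct; rewrite (dec_true _ Hx); easy).
    assert (HctU : forall x, ~ Q x -> ~ U x -> ct x = r x).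
    { intros x Hx Hu. unfold ct, out. rewrite (dec_false _ Hx), (dec_false _ Hu), Hr; easy. }
    destruct (gain_compare K) as [B HB].
    destruct (minimal_attained A ct (0 - B)%Z) as [d [[Hd1 [N Hd2]] Hd3]].
    { intros c' k [Hm Hb] Hg.
      set (r' := fun x => if dec (Q x) then c' x else r x).
      assert (Hr'Q : forall x, Q x -> r' x = c' x)
        by (intros x Hx; unfold r'; rewrite (dec_true _ Hx); easy).
      assert (Hr'n : forall x, ~ Q x -> r' x = r x)
        by (intros x Hx; unfold r'; rewrite (dec_false _ Hx); easy).
      assert (Hc'n : forall x, ~ Q x -> c' x = ct x) by (intros x Hx; apply Hm; unfold A; tauto).
      assert (Hmr : modif A r r').
      { split.
        - intros x Hx. destruct (classic (Q x)) as [Hq|Hq]; [|auto].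
          rewrite Hr'Q, Hm, HctQ; auto.
        - apply (bounded_sub _ _ Hb). intros x Hx.
          destruct (classic (Q x)) as [Hq|Hq].
          + rewrite HctQ, <- Hr'Q; auto.
          + destruct Hx. auto. }
      destruct (modif_gain A r r' ltac:(unfold A; tauto) Hmr) as [k' Hk'].
      pose proof (Hmin r' k' Hmr Hk') as Hpos.
      assert (k' - B <= k)%Z; [|lia].
      apply (HB ct c' r r' k k' Hg Hk').
      assert (HQ : forall u v, adj u v -> K <= u \/ K <= v -> Q u ->
        (same r' u v - same r u v <= same c' u v - same ct u v)%Z).
      { intros u v Huv Hge Hu.
        assert (Hv : r v = ct v /\ r' v = c' v).
        { destruct (classic (Q v)) as [Hv|Hv].
          - rewrite HctQ, Hr'Q; easy.
          - destruct (classic (U v)) as [HUv|HUv].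
            + destruct (HK u v); auto. lia.
            + rewrite Hr'n, Hc'n, HctU; easy. }
        rewrite (same_ext r' c'), (same_ext r ct); try lia; try apply Hv.
        - rewrite HctQ; easy.
        - auto. }
      intros u v Huv Hge. destruct (classic (Q u)) as [Hu|Hu]; [auto|].
      destruct (classic (Q v)) as [Hv|Hv].
      - rewrite !(same_sym _ u v). apply HQ; [auto|lia|easy].
      - rewrite (same_ext r' r), (same_ext c' ct); auto. lia. }
    exists N, d. split; [|split; [|easy]].
    + intros x Hx. rewrite Hd1 by (unfold A; tauto). unfold ct. rewrite (dec_false _ Hx). easy.
    + intros x Hx [Hi|Hi]; rewrite <- (HctQ x Hx).
      * apply Hd1. unfold A. tauto.
      * apply NNPP. intros Hn. specialize (Hd2 x Hn). lia.
  - exists N. intros t Ht. destruct (HN t) as [d [H1 [H2 H3]]].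
    exists d. split; [|easy]. intros x Hx. rewrite H1 by easy. unfold out.
    destruct (classic (U x)) as [Hu|Hu].
    + rewrite (dec_true _ Hu). easy.
    + rewrite (dec_false _ Hu), Ht; easy.
Qed.

Lemma extendable_assembly (U : nat -> Prop) (Q : nat -> nat -> Prop) :
  (forall n x, Q n x -> U x) ->
  (forall n m x, Q n x -> Q m x -> n = m) ->
  (forall x, U x -> ~ fin_deg x -> exists n, Q n x) ->
  (forall n, extendable (Q n)) ->
  (forall n, exists K, forall x y, Q n x -> U y -> ~ Q n y -> adj x y -> x < K /\ y < K) ->
  extendable U.
Proof.
  intros HQU Hdisj Hcov Hext Hbd c0.
  destruct (functional_choice _ _ _ (fun n => Hext n c0)) as [r Hr].
  destruct (functional_choice _ _ _ Hbd) as [K HK].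
  assert (HN : forall n, exists N, forall t, (forall x, ~ U x -> t x = c0 x) ->
    exists d, (forall x, ~ Q n x -> d x = t x) /\
      (forall x, Q n x -> ~ fin_deg x \/ N <= x -> d x = r n x) /\
      minimal (fun x => Q n x /\ fin_deg x) d).
  { intros n. destruct (Hr n) as [H1 [H2 _]]. apply (minimal_repair U (Q n) c0 (r n) (K n)); auto. }
  destruct (functional_choice _ _ _ HN) as [N HN']. clear HN.
  assert (Hrho : exists rho : nat -> bool,
    forall x, (forall n, Q n x -> rho x = r n x) /\ ((forall n, ~ Q n x) -> rho x = c0 x)).
  { apply (functional_choice nat bool (fun x b => (forall n, Q n x -> b = r n x) /\
      ((forall n, ~ Q n x) -> b = c0 x))).
    intros x. destruct (classic (exists n, Q n x)) as [[n Hn]|Hn].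
    - exists (r n x). split.
      + intros m Hm. rewrite (Hdisj n m x); easy.
      + intros H. destruct (H n Hn).
    - exists (c0 x). split; [|easy]. intros n Hx. destruct Hn. eauto. }
  destruct Hrho as [rho Hrho].
  (* Only these vertices are optimised globally: those of finite degree outside all pieces, and
     those below [N n] in piece [n]. Everything else in piece [n] keeps its colour from [r n]. *)
  set (A := fun x => U x /\ fin_deg x /\ forall n, Q n x -> x < N n).
  destruct (minimal_exists A rho) as [c [Hc1 Hc2]]; [unfold A; tauto|].
  assert (HcU : forall x, ~ U x -> c x = c0 x).
  { intros x Hx. rewrite Hc1 by (unfold A; tauto). apply Hrho. intros n Hn. apply Hx. eauto. }
  assert (HcQ : forall n x, Q n x -> ~ fin_deg x \/ N n <= x -> c x = r n x).
  { intros n x Hx Ho. rewrite Hc1.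
    - apply Hrho. easy.
    - intros [_ [H1 H2]]. destruct Ho as [Ho|Ho]; [easy|]. specialize (H2 n Hx). lia. }
  exists c. split; [easy|]. split.
  - intros c' k Hm Hg.
    assert (Hbound : exists m, forall x, c' x <> c x -> forall n, Q n x -> n < m).
    { apply (uniform_bounded (fun x => c' x <> c x) (fun x m => forall n, Q n x -> n < m)).
      - apply Hm.
      - intros x M M' Hle H n Hn. specialize (H n Hn). lia.
      - intros x _. destruct (classic (exists n, Q n x)) as [[n Hn]|Hn].
        + exists (S n). intros n' Hn'. rewrite (Hdisj n' n x); auto.
        + exists 0. intros n Hx. destruct Hn. eauto. }
    destruct Hbound as [m Hbound].
    (* Optimise the pieces one after another without increasing the energy, until the
       modification is confined to [A]. *)
    assert (Hloop : forall j, j <= m -> exists c'' k'',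
      modif (fun x => U x /\ fin_deg x) c c'' /\ gain c c'' k'' /\ (k'' <= k)%Z /\
      (forall n x, Q n x -> c'' x <> c x -> n < m) /\
      (forall n x, n < j -> Q n x -> N n <= x -> c'' x = c x)).
    { induction j as [|j IH]; intros Hj.
      { exists c', k. split; [easy|]. split; [easy|]. split; [lia|]. split; [|lia]. eauto. }
      destruct IH as [c'' [k'' [[Hm1 Hm2] [Hg' [Hle [Hlt Hag]]]]]]; [lia|].
      (* Piece [j] is repaired with [c''] around it. As [d] is minimal there, returning to [c'']
         gains some [g >= 0], so [d] has no more energy than [c'']. *)
      destruct (HN' j c'') as [d [Hd1 [Hd2 Hd3]]].
      { intros x Hx. rewrite Hm1 by tauto. auto. }
      assert (Hdc : forall x, Q j x -> ~ fin_deg x \/ N j <= x -> d x = c x).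
      { intros x Hx Ho. rewrite Hd2, HcQ with (n := j); auto. }
      assert (Hb : bounded (fun x => d x <> c x)).
      { assert (HNj : bounded (fun x => x < N j)) by (exists (N j); auto).
        apply (bounded_sub _ _ (bounded_or _ _ Hm2 HNj)). intros x Hx.
        destruct (classic (Q j x)) as [Hq|Hq].
        - right. destruct (le_lt_dec (N j) x); [|easy]. destruct Hx. auto.
        - left. rewrite <- Hd1; easy. }
      assert (Hmd : modif (fun x => Q j x /\ fin_deg x) d c'').
      { split.
        - intros x Hx. destruct (classic (Q j x)) as [Hq|Hq].
          + rewrite Hdc by tauto. apply Hm1. tauto.
          + rewrite Hd1; easy.
        - apply (bounded_sub _ _ (bounded_or _ _ Hm2 Hb)). intros x Hx.
          destruct (bool_dec (d x) (c x)); [left|right]; congruence. }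
      destruct (modif_gain (fun x => Q j x /\ fin_deg x) d c'' (fun x H => proj2 H) Hmd) as [g Hgd].
      pose proof (Hd3 c'' g Hmd Hgd) as Hpos.
      exists d, (k'' + - g)%Z. split; [split|split; [|split; [lia|split]]].
      - intros x Hx. destruct (classic (Q j x)) as [Hq|Hq].
        + apply Hdc; [easy|]. left. intros Hf. apply Hx. eauto.
        + rewrite Hd1 by easy. auto.
      - easy.
      - eapply gain_trans; [eauto|]. apply gain_sym. easy.
      - intros n x Hx Hne. destruct (Nat.eq_dec n j) as [->|Hnj]; [lia|].
        apply (Hlt n x Hx). rewrite <- Hd1; [easy|]. intros Hq. apply Hnj. eauto.
      - intros n x Hn Hx Hge. destruct (Nat.eq_dec n j) as [->|Hnj]; [auto|].
        rewrite Hd1; [|intros Hq; apply Hnj; eauto]. apply (Hag n x); [lia|easy|easy]. }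
    destruct (Hloop m (le_n m)) as [c'' [k'' [[Hm1 Hm2] [Hg' [Hle [Hlt Hag]]]]]].
    assert (0 <= k'')%Z; [|lia].
    apply (Hc2 c'' k''); [|easy]. split; [|easy].
    intros x Hx. apply NNPP. intros Hne. apply Hx. unfold A.
    assert (HUF : U x /\ fin_deg x) by (apply NNPP; intros Hn; auto).
    split; [easy|]. split; [easy|]. intros n Hn.
    destruct (le_lt_dec (N n) x); [|easy]. exfalso. apply Hne. apply (Hag n x); eauto.
  - intros x HUx Hinf. destruct (Hcov x HUx Hinf) as [n Hn].
    destruct (Hr n) as [Hr1 [Hr2 Hr3]].
    apply (happy_change (r n)); [auto|auto|].
    (* Neighbours where [c] and [r n] differ lie below [N n] inside the piece, or below [K n]
       outside it in [U]; outside [U] both equal [c0]. *)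
    exists (N n + K n). intros y [Hxy Hy].
    destruct (classic (Q n y)) as [Hq|Hq].
    + destruct (le_lt_dec (N n) y); [|lia]. destruct Hy. auto.
    + destruct (classic (U y)) as [Hu|Hu].
      * destruct (HK n x y); auto. lia.
      * destruct Hy. rewrite HcU, Hr1; easy.
Qed.

(** * Tame vertices *)

(** Closure under subsets is required because overlapping pieces are cut down to disjoint ones and
    vertices get deleted. *)
Definition hereditary (U : nat -> Prop) : Prop :=
  forall U' : nat -> Prop, (forall x, U' x -> U x) -> extendable U'.

Definition finite_cut (U Y : nat -> Prop) : Prop :=
  exists K, forall a b, Y a -> U b -> ~ Y b -> adj a b -> a < K /\ b < K.

Definition tame (U : nat -> Prop) (x : nat) : Prop :=
  exists Y : nat -> Prop,
    Y x /\ (forall y, Y y -> U y) /\ hereditary Y /\ finite_cut U Y.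

Definition minus (U : nat -> Prop) (x : nat) : nat -> Prop := fun y => U y /\ y <> x.

Lemma hereditary_sub U U' : (forall x, U' x -> U x) -> hereditary U -> hereditary U'.
Proof. intros H HU U'' HU''. apply HU. auto. Qed.

Lemma hereditary_add U x :
  ~ fin_deg x -> hereditary U -> hereditary (fun y => U y \/ y = x).
Proof.
  intros Hx HU U' HU'.
  assert (He : extendable (fun y => U' y /\ y <> x)).
  { apply HU. intros y [Hy Hne]. destruct (HU' y Hy); tauto. }
  destruct (classic (U' x)) as [H|H].
  - apply (extendable_ext (fun y => (U' y /\ y <> x) \/ y = x)).
    + intros y. destruct (Nat.eq_dec y x) as [->|]; tauto.
    + apply extendable_add; easy.
  - revert He. apply extendable_ext. intros y. split; [tauto|]. intros Hy. split; [easy|]. congruence.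
Qed.

(** The countably many pieces around the vertices are made disjoint by removing the earlier ones. A
    cut edge of the [n]-th remainder is a cut edge of one of the first [n + 1] original pieces, so
    the cuts stay finite. *)
Lemma hereditary_tame U :
  (forall x, U x -> ~ fin_deg x -> tame U x) -> hereditary U.
Proof.
  intros H U' HU'.
  assert (HY : forall n, exists Y : nat -> Prop,
    (U n -> ~ fin_deg n -> Y n) /\ hereditary Y /\ finite_cut U Y).
  { intros n. destruct (classic (U n /\ ~ fin_deg n)) as [[H1 H2]|Hn].
    - destruct (H n H1 H2) as [Y [Ha [_ [Hb Hc]]]]. exists Y. auto.
    - exists (fun _ => False). split; [tauto|]. split.
      + intros U'' HU''. apply extendable_fin_deg. intros x Hx. destruct (HU'' x Hx).
      + exists 0. tauto. }
  destruct (functional_choice _ _ _ HY) as [Y HY']. clear HY.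
  apply (extendable_assembly U' (fun n x => U' x /\ Y n x /\ forall i, i < n -> ~ Y i x)).
  - tauto.
  - intros n m x [_ [H1 H2]] [_ [H3 H4]]. destruct (lt_eq_lt_dec n m) as [[Hlt|Heq]|Hlt]; auto.
    + destruct (H4 n Hlt H1).
    + destruct (H2 m Hlt H3).
  - intros x Hx Hinf.
    assert (Hex : exists n, Y n x) by (exists x; apply HY'; auto).
    destruct Hex as [n Hn]. induction n as [n IH] using lt_wf_ind.
    destruct (classic (exists i, i < n /\ Y i x)) as [[i [Hi1 Hi2]]|Hno].
    + eauto.
    + exists n. repeat split; auto. intros i Hi Hyi. eauto.
  - intros n. destruct (HY' n) as [_ [Hh _]]. apply Hh. tauto.
  - intros n.
    destruct (uniform_below (fun i K => forall a b, Y i a -> U b -> ~ Y i b -> adj a b ->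
      a < K /\ b < K) (S n)) as [K HK].
    + intros i K K' Hle Hi a b Ha Hb Hnb Hab. specialize (Hi a b Ha Hb Hnb Hab). lia.
    + intros i _. apply HY'.
    + exists K. intros x y [Hx1 [Hx2 Hx3]] Hy Hny Hxy.
      destruct (classic (Y n y)) as [Hyn|Hyn].
      * assert (Hi : exists i, i < n /\ Y i y).
        { apply NNPP. intros Hi. apply Hny. repeat split; auto. intros i Hlt Hyi. eauto. }
        destruct Hi as [i [Hlt Hyi]]. apply and_comm. apply (HK i); auto.
      * apply (HK n); auto.
Qed.

(** All vertices are tame: [Y] has a finite cut, and the rest of [Z] is separated by the same
    edges. *)
Lemma hereditary_union Y Z :
  hereditary Y -> hereditary Z -> finite_cut (fun x => Y x \/ Z x) Y ->
  hereditary (fun x => Y x \/ Z x).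
Proof.
  intros HY HZ HK. apply hereditary_tame. intros x Hx _.
  destruct (classic (Y x)) as [H|H].
  - exists Y. auto.
  - exists (fun z => Z z /\ ~ Y z). split; [tauto|]. split; [tauto|]. split.
    + apply (hereditary_sub Z); [tauto|easy].
    + destruct HK as [K HK]. exists K. intros a b [Ha1 Ha2] Hb1 Hb2 Hab.
      apply and_comm. apply (HK b a); auto. destruct Hb1; [easy|].
      apply NNPP. tauto.
Qed.

(** A [w] of finite degree adds finitely many edges to the cut of the piece of [x]; a tame [w] is
    absorbed by joining its own piece. Contrapositively, wild vertices survive the deletion of
    [w]. *)
Lemma tame_minus U w x :
  fin_deg w \/ tame U w -> tame (minus U w) x -> tame U x.
Proof.
  intros Hw [Y [H1 [H2 [H3 [K HK]]]]].
  destruct Hw as [[M HM]|[Z [Hz1 [Hz2 [Hz3 [L HL]]]]]].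
  - exists Y. split; [easy|]. split; [intros y Hy; apply H2; easy|]. split; [easy|].
    exists (K + M + S w). intros a b Ha Hb Hnb Hab.
    destruct (Nat.eq_dec b w) as [->|Hne].
    + specialize (HM a (adj_sym _ _ Hab)). lia.
    + destruct (HK a b Ha (conj Hb Hne) Hnb Hab). lia.
  - exists (fun y => Z y \/ Y y). split; [tauto|]. split; [|split].
    + intros y [Hy|Hy]; [auto|]. apply H2. easy.
    + apply hereditary_union; auto. exists L. intros a b Ha Hb Hnb Hab. apply HL; auto.
      destruct Hb as [Hb|Hb]; [auto|]. apply H2. easy.
    + exists (K + L). intros a b Ha Hb Hnb Hab. destruct Ha as [Ha|Ha].
      * destruct (HL a b); auto. lia.
      * destruct (HK a b); auto; [|lia]. split; [easy|]. intros ->. tauto.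
Qed.

(** * Rays through wild vertices *)

Inductive walk (U : nat -> Prop) : nat -> nat -> nat -> Prop :=
| walk_nil x : U x -> walk U 0 x x
| walk_cons n x y z : U x -> adj x y -> walk U n y z -> walk U (S n) x z.

Lemma walk_start U n x y : walk U n x y -> U x.
Proof. now destruct 1. Qed.

Lemma walk_end U n x y : walk U n x y -> U y.
Proof. now induction 1. Qed.

Lemma walk_snoc U n x y z : walk U n x y -> adj y z -> U z -> walk U (S n) x z.
Proof.
  intros H Hyz Hz. induction H as [x Hx|n x x' y Hx Hxx' H IH].
  - apply walk_cons with z; auto. apply walk_nil. easy.
  - apply walk_cons with x'; auto.
Qed.

Lemma walk_avoid U w n x y :
  walk U n x y -> walk (minus U w) n x y \/ exists k, k <= n /\ walk U k w y.
Proof.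
  induction 1 as [x Hx|n x x' y Hx Hxx' H IH].
  - destruct (Nat.eq_dec x w) as [->|Hne].
    + right. exists 0. split; [lia|]. apply walk_nil. easy.
    + left. apply walk_nil. split; easy.
  - destruct IH as [IH|[k [Hk1 Hk2]]].
    + destruct (Nat.eq_dec x w) as [->|Hne].
      * right. exists (S n). split; [lia|]. apply walk_cons with x'; easy.
      * left. apply walk_cons with x'; auto. split; easy.
    + right. exists k. split; [lia|easy].
Qed.

(** The walk is restarted at its last visit to [x]. *)
Lemma walk_leave U n x y :
  walk U n x y -> x <> y ->
  exists k x', k < n /\ adj x x' /\ walk (minus U x) k x' y.
Proof.
  induction n as [n IH] using lt_wf_ind. intros H Hne.
  destruct H as [x Hx|n x x' y Hx Hxx' H]; [easy|].
  destruct (walk_avoid U x n x' y H) as [Ha|[k [Hk1 Hk2]]].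
  - exists n, x'. split; [lia|easy].
  - destruct (IH k) as [j [z [Hj Hz]]]; [lia|easy|easy|].
    exists j, z. split; [lia|easy].
Qed.

(** Each vertex is deleted as the route leaves it, and wildness of the end refers to what remains.
    Concatenated routes therefore never repeat a vertex. *)
Fixpoint route (n : nat) (U : nat -> Prop) (x : nat) : Prop :=
  U x /\ match n with
         | 0 => ~ fin_deg x /\ ~ tame U x
         | S n => exists y, adj x y /\ route n (minus U x) y
         end.

Lemma walk_route n : forall U x y,
  walk U n x y -> ~ fin_deg y -> ~ tame U y -> exists m, route m U x.
Proof.
  induction n as [n IH] using lt_wf_ind. intros U x y H Hinf Hwild.
  pose proof (walk_start _ _ _ _ H) as Hx.
  destruct (classic (~ fin_deg x /\ ~ tame U x)) as [Hw|Hw].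
  - exists 0. easy.
  - destruct (walk_leave U n x y H) as [k [x' [Hk [Hxx' H']]]]; [intros ->; tauto|].
    destruct (IH k Hk (minus U x) x' y H' Hinf) as [m Hm].
    + intros Ht. apply Hwild. apply (tame_minus U x); [|easy].
      destruct (classic (fin_deg x)); [tauto|]. right. apply NNPP. tauto.
    + exists (S m). split; [easy|]. eauto.
Qed.

(** Otherwise every vertex of infinite degree reachable from [x] in [U] minus [x] is tame there. The
    reachable part is then hereditary, and together with [x] it has an empty cut in [U], making [x]
    tame. *)
Lemma wild_step U x :
  U x -> ~ fin_deg x -> ~ tame U x ->
  exists y m, adj x y /\ route m (minus U x) y.
Proof.
  intros Hx Hinf Hwild. apply NNPP. intros Hno. apply Hwild.
  set (near := fun y => exists w n, adj x w /\ walk (minus U x) n w y).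
  assert (HnU : forall y, near y -> minus U x y).
  { intros y [w [n [_ Hw]]]. apply (walk_end _ _ _ _ Hw). }
  assert (Hclosed : forall y z, near y -> adj y z -> minus U x z -> near z).
  { intros y z [w [n [Hxw Hw]]] Hyz Hz. exists w, (S n). split; [easy|]. apply walk_snoc with y; easy. }
  exists (fun y => near y \/ y = x). split; [tauto|]. split; [|split].
  - intros y [Hy| ->]; [|easy]. apply HnU. easy.
  - apply hereditary_add; [easy|]. apply hereditary_tame. intros y Hy Hinfy.
    assert (Ht : tame (minus U x) y).
    { apply NNPP. intros Ht. destruct Hy as [w [n [Hxw Hw]]].
      destruct (walk_route n _ _ _ Hw Hinfy Ht) as [m Hm]. apply Hno. eauto. }
    destruct Ht as [Y [H1 [H2 [H3 [K HK]]]]].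
    exists (fun z => Y z /\ near z). split; [easy|]. split; [tauto|]. split.
    + apply (hereditary_sub Y); [tauto|easy].
    + exists K. intros a b [Ha1 Ha2] Hb Hnb Hab. apply HK; auto; tauto.
  - exists 0. intros a b Ha Hb Hnb Hab. exfalso. apply Hnb.
    destruct (Nat.eq_dec b x) as [->|Hne]; [tauto|]. left.
    assert (Hbm : minus U x b) by (split; easy).
    destruct Ha as [Ha| ->].
    + apply (Hclosed a b); easy.
    + exists b, 0. split; [easy|]. apply walk_nil. easy.
Qed.

Lemma route_step m U x :
  route m U x ->
  exists y m', adj x y /\ route m' (minus U x) y /\ (m = 0 \/ m = S m').
Proof.
  destruct m as [|m]; intros [Hx H].
  - destruct (wild_step U x Hx) as [y [m' [H1 H2]]]; [easy|easy|]. exists y, m'. auto.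
  - destruct H as [y [H1 H2]]. exists y, m. auto.
Qed.

Theorem hereditary_of_no_ray (U : nat -> Prop) :
  (forall r : nat -> nat,
     (forall m n, r m = r n -> m = n) -> (forall n, adj (r n) (r (S n))) ->
     (forall n, U (r n)) -> ~ infinitely_often (fun n => ~ fin_deg (r n))) ->
  hereditary U.
Proof.
  intros Hray. apply hereditary_tame. intros x Hx Hinf. apply NNPP. intros Hwild.
  (* The state holds the remaining set, the current vertex and a countdown to the next wild
     vertex. *)
  destruct (dependent_choice ((nat -> Prop) * nat * nat)
    (fun _ t => let '(V, v, m) := t in route m V v)
    (fun t t' => let '(V, v, m) := t in let '(V', v', m') := t' in
       adj v v' /\ V' = minus V v /\ (m = 0 \/ m = S m')) (U, x, 0)) as [f [Hf0 [Hf1 Hf2]]].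
  - easy.
  - intros _ [[V v] m] H. destruct (route_step m V v H) as [y [m' [H1 [H2 H3]]]].
    exists (minus V v, y, m'). auto.
  - set (V := fun n => fst (fst (f n))). set (r := fun n => snd (fst (f n))).
    set (l := fun n => snd (f n)).
    assert (Hr : forall n, route (l n) (V n) (r n)).
    { intros n. specialize (Hf1 n). unfold l, V, r. destruct (f n) as [[? ?] ?]. easy. }
    assert (Hs : forall n, adj (r n) (r (S n)) /\ V (S n) = minus (V n) (r n) /\
      (l n = 0 \/ l n = S (l (S n)))).
    { intros n. specialize (Hf2 n). unfold l, V, r.
      destruct (f n) as [[? ?] ?], (f (S n)) as [[? ?] ?]. easy. }
    assert (HV : forall n, V n (r n)).
    { intros n. specialize (Hr n). destruct (l n); apply Hr. }
    assert (Hdec : forall m n y, m <= n -> V n y -> V m y).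
    { intros m n y Hle. induction Hle as [|n Hle IH]; [easy|]. intros Hy. apply IH.
      rewrite (proj1 (proj2 (Hs n))) in Hy. apply Hy. }
    assert (Hlt : forall m n, m < n -> r m <> r n).
    { intros m n Hmn E. pose proof (Hdec (S m) n (r n) Hmn (HV n)) as Hy.
      rewrite (proj1 (proj2 (Hs m))) in Hy. destruct Hy. congruence. }
    apply (Hray r).
    + intros m n E. destruct (lt_eq_lt_dec m n) as [[H|H]|H]; [|easy|].
      * destruct (Hlt m n H E).
      * destruct (Hlt n m H (eq_sym E)).
    + intros n. apply Hs.
    + intros n. assert (H0 : V 0 = U) by (unfold V; rewrite Hf0; easy).
      rewrite <- H0. apply (Hdec 0 n); [lia|apply HV].
    (* When the countdown reaches 0, the current vertex has infinite degree. *)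
    + intros n. remember (l n) as k eqn:Hk. revert n Hk.
      induction k as [|k IH]; intros n Hk.
      * exists n. split; [lia|]. specialize (Hr n). rewrite <- Hk in Hr. apply Hr.
      * destruct (IH (S n)) as [j [Hj1 Hj2]].
        -- destruct (Hs n) as [_ [_ [E|E]]]; congruence.
        -- exists j. split; [lia|easy].
Qed.

(** * Majorities *)

(** Flipping [v] alone exchanges monochromatic and bichromatic edges at [v], so the energy change is
    the difference of the two numbers, and minimality makes it nonnegative. *)
Lemma minimal_majority A c v :
  (forall x, ~ adj x x) -> minimal A c -> A v -> fin_deg v ->
  injects (fun u => adj v u /\ c u = c v) (fun u => adj v u /\ c u <> c v).
Proof.
  intros Hirr Hmin HA [M HM].
  set (c' := update c v (negb (c v))).
  assert (Hc'v : c' v = negb (c v)) by (unfold c', update; destruct (Nat.eq_dec v v); easy).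
  assert (Hc' : forall y, y <> v -> c' y = c y)
    by (intros y Hy; unfold c', update; destruct (Nat.eq_dec y v); easy).
  assert (Hm : modif A c c').
  { split.
    - intros x Hx. apply Hc'. congruence.
    - exists (S v). intros x Hx. destruct (Nat.eq_dec x v); [lia|]. destruct Hx. auto. }
  set (inc := fun p => let (u, w) := of_nat p in adj u w /\ u < w /\ (u = v \/ w = v)).
  set (mono := fun p => let (u, w) := of_nat p in c u = c w).
  assert (Hnb : forall u w, adj u w -> u = v \/ w = v -> u < M + S v /\ w < M + S v).
  { intros u w Huw [->| ->].
    - specialize (HM w Huw). lia.
    - specialize (HM u (adj_sym _ _ Huw)). lia. }
  destruct (gain_exists c c' (M + S v)) as [k Hk].
  { intros u w Huw Hge.
    destruct (Nat.eq_dec u v) as [Hu|Hu]; [destruct (Hnb u w); auto; lia|].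
    destruct (Nat.eq_dec w v) as [Hw|Hw]; [destruct (Hnb u w); auto; lia|].
    apply same_ext; auto. }
  pose proof (Hmin c' k Hm Hk) as Hpos.
  destruct Hk as [N0 HN0]. destruct (code_bound (M + S v)) as [B HB].
  specialize (HN0 (N0 + B) ltac:(lia)).
  destruct (injects_of_sum (fun p => inc p /\ mono p) (fun p => inc p /\ ~ mono p) (N0 + B))
    as [g [Hg1 Hg2]].
  { assert (Hs : forall n, sum (fun p => (if dec (inc p /\ ~ mono p) then 1 else 0) -
      (if dec (inc p /\ mono p) then 1 else 0))%Z n = (energy c' n - energy c n)%Z).
    { induction n as [|n IH]; [easy|]. unfold energy in *. cbn [sum]. rewrite IH.
      assert (He : ((if dec (inc n /\ ~ mono n) then 1 else 0) -
        (if dec (inc n /\ mono n) then 1 else 0) = edge_energy c' n - edge_energy c n)%Z); [|lia].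
      unfold inc, mono, edge_energy. destruct (of_nat n) as [u w].
      destruct (classic (adj u w /\ u < w)) as [[Huw Hlt]|Hno].
      - rewrite (dec_true (adj u w /\ u < w)) by easy.
        destruct (classic (u = v \/ w = v)) as [Hv|Hv].
        + assert (Hcc : c' u = negb (c u) /\ c' w = c w \/ c' u = c u /\ c' w = negb (c w)).
          { destruct Hv as [->| ->]; [left|right]; split; auto; apply Hc'; intros ->; lia. }
          destruct (bool_dec (c u) (c w)) as [E|E].
          * rewrite dec_false, dec_true by tauto. unfold same.
            destruct Hcc as [[-> ->]|[-> ->]]; rewrite E; destruct (c w); simpl; lia.
          * rewrite dec_true, dec_false by tauto. unfold same.
            destruct Hcc as [[-> ->]|[-> ->]]; destruct (c u), (c w); simpl; congruence || lia.
        + rewrite !dec_false by tauto. rewrite (same_ext c' c) by (apply Hc'; tauto). lia.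
      - rewrite !dec_false by tauto. lia. }
    rewrite Hs. lia. }
  (* Neighbours of [v] are translated to edge codes with the smaller end first, matching
     [edge_energy], and back. *)
  set (edge := fun u => to_nat (min v u, max v u)).
  assert (Hof : forall u, of_nat (edge u) = (min v u, max v u)) by (intros; apply cancel_of_to).
  assert (Hinj : forall u w, edge u = edge w -> u = w).
  { intros u w E. pose proof (Hof u) as E1. rewrite E, Hof in E1. injection E1. lia. }
  assert (Hmm : forall u, adj v u -> (min v u = v /\ max v u = u \/ min v u = u /\ max v u = v) /\ v <> u).
  { intros u Hu. split; [lia|]. intros <-. apply (Hirr v Hu). }
  assert (Hto : forall u, adj v u -> c u = c v -> inc (edge u) /\ mono (edge u) /\ edge u < N0 + B).
  { intros u Hu Hcu. destruct (Hmm u Hu) as [Hmu Hne].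
    assert (Ha : adj (min v u) (max v u)) by (destruct Hmu as [[-> ->]|[-> ->]]; auto).
    assert (Hv : min v u = v \/ max v u = v) by lia.
    unfold inc, mono. rewrite Hof. split; [|split].
    - split; [easy|]. split; [lia|easy].
    - destruct Hmu as [[-> ->]|[-> ->]]; auto.
    - destruct (le_lt_dec B (edge u)) as [Hle|]; [|lia].
      destruct (Hnb _ _ Ha Hv). destruct (HB _ _ _ (Hof u) Hle); lia. }
  assert (Hfrom : forall p, inc p /\ ~ mono p -> exists w, (adj v w /\ c w <> c v) /\ edge w = p).
  { intros p. unfold inc, mono. destruct (of_nat p) as [s t] eqn:Hp. intros [[Hst [Hlt Hv]] Hc].
    assert (Hpe : p = to_nat (s, t)) by (rewrite <- Hp, cancel_to_of; easy).
    destruct Hv as [->| ->].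
    - exists t. split; [auto|]. unfold edge. rewrite Nat.min_l, Nat.max_r by lia. easy.
    - exists s. split; [auto|]. unfold edge. rewrite Nat.min_r, Nat.max_l by lia. easy. }
  destruct (functional_choice nat nat (fun u w => adj v u /\ c u = c v ->
    (adj v w /\ c w <> c v) /\ edge w = g (edge u))) as [h Hh].
  { intros u. destruct (classic (adj v u /\ c u = c v)) as [[Hu1 Hu2]|Hu]; [|exists 0; tauto].
    destruct (Hto u Hu1 Hu2) as [H1 [H2 H3]].
    destruct (Hfrom (g (edge u))) as [w Hw]; [auto|]. exists w. auto. }
  exists h. split.
  - intros u Hu. apply Hh. easy.
  - intros u w Hu Hw E. apply Hinj.
    destruct (Hto u) as [H1 [H2 H3]]; try apply Hu.
    destruct (Hto w) as [H4 [H5 H6]]; try apply Hw.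
    apply Hg2; auto. rewrite <- (proj2 (Hh u Hu)), <- (proj2 (Hh w Hw)), E. easy.
Qed.

End Graph.

(** * Disjoint refinements *)

(** A strictly increasing sequence [ys] serves at step [k] the set indexed by the first component of
    [k], so each index is served infinitely often; [par] records whom an element serves. *)
Lemma disjoint_refinement (A : nat -> nat -> Prop) :
  exists par : nat -> nat,
    forall z, ~ bounded (A z) -> ~ bounded (fun y => A z y /\ par y = z).
Proof.
  set (P := fun k y => ~ bounded (A (fst (of_nat k))) -> A (fst (of_nat k)) y).
  assert (Hnext : forall k n, exists y, n <= y /\ P k y).
  { intros k n. unfold P. destruct (classic (bounded (A (fst (of_nat k))))) as [H|H].
    - exists n. split; [lia|tauto].
    - destruct (unbounded_ge _ H n) as [y [H1 H2]]. eauto. }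
  destruct (Hnext 0 0) as [y0 [_ Hy0]].
  destruct (dependent_choice nat P lt y0 Hy0) as [ys [_ [H1 H2]]].
  { intros k y _. destruct (Hnext (S k) (S y)) as [y' [Ha Hb]]. exists y'. split; [easy|lia]. }
  assert (Hmono : forall m n, m < n -> ys m < ys n).
  { intros m n H. induction H as [|n H IH]; [auto|]. specialize (H2 n). lia. }
  assert (Hge : forall n, n <= ys n).
  { induction n as [|n IH]; [lia|]. specialize (H2 n). lia. }
  destruct (functional_choice nat nat (fun y z => forall k, ys k = y -> z = fst (of_nat k)))
    as [par Hpar].
  { intros y. destruct (classic (exists k, ys k = y)) as [[k Hk]|Hn].
    - exists (fst (of_nat k)). intros k' Hk'. replace k' with k; [easy|].
      destruct (lt_eq_lt_dec k k') as [[H|H]|H]; [|easy|]; apply Hmono in H; lia.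
    - exists 0. intros k Hk. destruct Hn. eauto. }
  exists par. intros z Hz [N HN].
  set (k := to_nat (z, N)).
  assert (Hk : fst (of_nat k) = z) by (unfold k; rewrite cancel_of_to; easy).
  specialize (H1 k). unfold P in H1. rewrite Hk in H1.
  specialize (HN (ys k)). rewrite (Hpar (ys k) k eq_refl), Hk in HN.
  specialize (HN (conj (H1 Hz) eq_refl)). specialize (Hge k).
  pose proof (to_nat_non_decreasing z N). unfold k in *. lia.
Qed.

(** Each [z] owns the two indices [2 * z] and [2 * z + 1]; the parity of the index served by [y] is
    its colour, so an infinite [A z] receives both colours infinitely often. *)
Lemma infinite_degree_coloring (A : nat -> nat -> Prop) :
  exists b : nat -> bool,
    forall z, ~ bounded (A z) -> ~ bounded (fun y => A z y /\ b y <> b z).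
Proof.
  destruct (disjoint_refinement (fun n => A (Nat.div2 n))) as [par Hpar].
  exists (fun y => Nat.odd (par y)). intros z Hz Hb.
  assert (Hn : exists n, Nat.div2 n = z /\ Nat.odd n <> Nat.odd (par z)).
  { destruct (Nat.odd (par z)) eqn:E.
    - exists (2 * z). split; [apply Nat.div2_double|]. rewrite Nat.odd_even. easy.
    - exists (S (2 * z)). split; [apply Nat.div2_succ_double|].
      rewrite <- Nat.add_1_r, Nat.odd_odd. easy. }
  destruct Hn as [n [Hn1 Hn2]]. specialize (Hpar n). rewrite Hn1 in Hpar.
  apply (Hpar Hz). apply (bounded_sub _ _ Hb). intros y [Hy1 Hy2]. rewrite Hy2. easy.
Qed.

(** * Ranking the vertices of infinite degree *)

Section Reduction.
Context (adj : nat -> nat -> Prop) (adj_sym : forall u v, adj u v -> adj v u).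
Context (adj_irrefl : forall v, ~ adj v v).

Let inf (x : nat) : Prop := ~ bounded (adj x).

Definition next (T : nat -> Prop) : nat -> Prop :=
  fun x => T x \/ inf x /\ bounded (fun y => adj x y /\ inf y /\ ~ T y).

(* The transfinite iterates of [next], starting from the empty set. *)
Inductive stage : (nat -> Prop) -> Prop :=
| stage_next T : stage T -> stage (next T)
| stage_union (C : (nat -> Prop) -> Prop) :
    (forall T, C T -> stage T) -> stage (fun x => exists T, C T /\ T x).

Definition incl (T T' : nat -> Prop) : Prop := forall x, T x -> T' x.

Lemma next_mono T T' : incl T T' -> incl (next T) (next T').
Proof.
  intros H x [Hx|[Hx Hb]]; [left; auto|]. right. split; [easy|].
  apply (bounded_sub _ _ Hb). intros y [H1 [H2 H3]]. split; [easy|]. split; [easy|]. auto.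
Qed.

(** Nested induction on both stages, as for Zermelo towers; it replaces the comparison of
    ordinals. *)
Lemma stage_linear T : stage T -> forall T', stage T' -> incl T' T \/ incl (next T) T'.
Proof.
  induction 1 as [T HT IH|C HC IH]; intros T' HT'.
  - induction HT' as [T' HT' IH'|C' HC' IH'].
    + destruct IH' as [H|H].
      * destruct (IH T' HT') as [H'|H'].
        -- left. apply next_mono. easy.
        -- right. apply next_mono. easy.
      * right. intros x Hx. left. auto.
    + destruct (classic (exists T', C' T' /\ incl (next (next T)) T')) as [[T' [H1 H2]]|Hn].
      * right. intros x Hx. exists T'. auto.
      * left. intros x [T' [H1 H2]]. destruct (IH' T' H1) as [H|H]; [auto|]. destruct Hn. eauto.
  - set (U := fun x => exists T, C T /\ T x) in *.
    assert (HCU : forall T, C T -> incl T U) by (intros T HT x Hx; exists T; easy).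
    induction HT' as [T' HT' IH'|C' HC' IH'].
    + destruct IH' as [H|H]; [|right; intros x Hx; left; auto].
      destruct (classic (exists T, C T /\ incl T' T)) as [[T [H1 H2]]|Hn].
      * destruct (classic (exists T'', C T'' /\ incl (next T) T'')) as [[T'' [H3 H4]]|Hn'].
        -- left. intros x Hx. apply (HCU T'' H3). apply H4. apply (next_mono T' T); easy.
        -- assert (HUT : incl U T).
           { intros x [T'' [H3 H4]]. destruct (IH T H1 T'') as [H5|H5]; auto.
             destruct Hn'. eauto. }
           destruct (IH T H1 (next T')) as [H5|H5]; [apply stage_next; easy| |].
           ++ left. intros x Hx. apply (HCU T H1). auto.
           ++ right. intros x Hx. apply H5. apply (next_mono U T); easy.
      * right. apply next_mono. intros x [T [H1 H2]].
        destruct (IH T H1 T' HT') as [H3|H3]; [destruct Hn; eauto|]. apply H3. left. easy.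
    + destruct (classic (exists T', C' T' /\ incl (next U) T')) as [[T' [H1 H2]]|Hn].
      * right. intros x Hx. exists T'. auto.
      * left. intros x [T' [H1 H2]]. destruct (IH' T' H1) as [H|H]; [auto|]. destruct Hn. eauto.
Qed.

Definition ranked (x : nat) : Prop := exists T, stage T /\ T x.

Definition prec (y x : nat) : Prop := exists T, stage T /\ T y /\ ~ T x.

Lemma prec_wf x : ranked x -> Acc prec x.
Proof.
  intros [T [HT Hx]]. revert x Hx.
  induction HT as [T HT IH|C HC IH]; intros x Hx.
  - destruct (classic (T x)) as [Htx|Htx]; [auto|].
    constructor. intros y [T' [H1 [H2 H3]]].
    destruct (stage_linear T HT T' H1) as [H|H]; [auto|]. destruct H3. auto.
  - destruct Hx as [T [H1 H2]]. eauto.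
Qed.

(** The union [T] of all stages missing [x] is itself a stage, and [next T] contains [x]: otherwise
    [T] would be closed under [next] and contain every stage. Members of [T] are ranked and precede
    [x]. *)
Lemma ranked_spec x :
  ranked x -> inf x /\ bounded (fun y => adj x y /\ inf y /\ ~ (ranked y /\ prec y x)).
Proof.
  intros [T0 [HT0 Hx0]].
  set (T := fun y => exists T, (stage T /\ ~ T x) /\ T y).
  assert (HT : stage T) by (apply stage_union; tauto).
  assert (Hx : ~ T x) by (intros [T' H]; tauto).
  assert (Hn : next T x).
  { apply NNPP. intros Hn.
    assert (Hfix : incl (next T) T).
    { intros y Hy. exists (next T). split; [|easy]. split; [apply stage_next; easy|easy]. }
    assert (Hall : forall S, stage S -> incl S T).
    { induction 1 as [S HS IH|C HC IH].
      - intros y Hy. apply Hfix. apply (next_mono S T); easy.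
      - intros y [S [H1 H2]]. apply (IH S H1). easy. }
    apply Hx. apply (Hall T0); easy. }
  destruct Hn as [Hn|[Hn Hb]]; [easy|]. split; [easy|].
  apply (bounded_sub _ _ Hb). intros y [H1 [H2 H3]]. split; [easy|]. split; [easy|].
  intros Hy. apply H3. split; exists T; easy.
Qed.

Lemma unranked_spec x :
  inf x -> ~ ranked x -> ~ bounded (fun y => adj x y /\ inf y /\ ~ ranked y).
Proof.
  intros Hi Hx Hb. apply Hx.
  set (T := fun y => exists T, stage T /\ T y).
  exists (next T). split; [apply stage_next, stage_union; easy|]. right. split; easy.
Qed.

(** * Forgetting the edges between vertices of infinite degree *)

Lemma unfriendly_nat :
  (forall r : nat -> nat,
     (forall m n, r m = r n -> m = n) -> (forall n, adj (r n) (r (S n))) ->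
     infinitely_often (fun n => bounded (adj (r n))) ->
     ~ infinitely_often (fun n => ~ bounded (adj (r n)))) ->
  exists c : nat -> bool, forall v,
    injects (fun u => adj v u /\ c u = c v) (fun u => adj v u /\ c u <> c v).
Proof.
  intros Hray.
  destruct (infinite_degree_coloring (fun z y => adj z y /\ inf y /\ ~ ranked y)) as [b Hb].
  (* A ranked vertex [z] with finitely many neighbours of finite degree relies on the
     neighbours [y] of lower rank with [par y = z].  These edges form a forest; [z < y] rules
     out infinite ascending paths, and the rank rules out descending ones. *)
  set (A := fun z y => adj z y /\ ranked y /\ prec y z /\ z < y).
  destruct (disjoint_refinement A) as [par Hpar].
  set (child := fun z y => A z y /\ par y = z).
  set (H := fun u v => adj u v /\ (bounded (adj u) \/ bounded (adj v) \/ child u v \/ child v u)).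
  assert (H_sym : forall u v, H u v -> H v u) by (unfold H; intros u v [? ?]; split; [auto|tauto]).
  (* Outside [U] lie exactly the unranked vertices of infinite degree, which [b] colours in
     advance. *)
  set (U := fun x => inf x -> ranked x).
  assert (HF : forall x, bounded (adj x) -> fin_deg H x).
  { intros x Hx. apply (bounded_sub _ _ Hx). unfold H. tauto. }
  (* If [x] kept only finitely many edges, almost all its neighbours would have infinite degree and
     lower rank, so [A x] would be infinite and [x] would have infinitely many children. *)
  assert (HI : forall x, U x -> inf x -> ~ fin_deg H x).
  { intros x HU Hx Hfin.
    destruct (ranked_spec x (HU Hx)) as [_ Hrk].
    assert (HFx : bounded (fun y => adj x y /\ ~ inf y)).
    { apply (bounded_sub _ _ Hfin). intros y [H1 H2]. split; [easy|]. right. left. apply NNPP. easy. }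
    apply (Hpar x).
    - intros HA. apply Hx.
      assert (HSx : bounded (fun y => y <= x)) by (exists (S x); lia).
      apply (bounded_sub _ _ (bounded_or _ _ (bounded_or _ _ HA HSx) (bounded_or _ _ HFx Hrk))).
      intros y Hy. destruct (classic (inf y)); [|tauto].
      destruct (classic (ranked y /\ prec y x)) as [[H1 H2]|]; [|tauto].
      destruct (le_lt_dec y x); [tauto|]. left. left. split; easy.
    - apply (bounded_sub _ _ Hfin). intros y [H1 H2]. split; [apply H1|]. right. right. left.
      split; easy. }
  assert (Hher : hereditary H U).
  { apply hereditary_of_no_ray; [easy|]. intros r Hinj Hadj HU Hinf.
    assert (Hinf' : infinitely_often (fun n => inf (r n))).
    { intros N. destruct (Hinf N) as [n [Hn1 Hn2]]. exists n. split; [easy|]. intros Hfin.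
      apply Hn2. auto. }
    apply (Hray r); auto; [intros n; apply Hadj|].
    apply NNPP. intros Hno. apply not_all_ex_not in Hno. destruct Hno as [N HN].
    assert (HN' : forall n, N <= n -> inf (r n)) by (intros n Hn Hfin; apply HN; eauto).
    assert (Hstep : forall n, N <= n -> child (r n) (r (S n)) \/ child (r (S n)) (r n)).
    { intros n Hn. destruct (Hadj n) as [_ [Hf|[Hf|Hf]]]; [| |easy].
      - destruct (HN' n Hn Hf).
      - destruct (HN' (S n) ltac:(lia) Hf). }
    (* From [N] on the ray runs in the forest. Parents are unique and the ray is injective, so after
       one step to a child all steps go to children and the rank falls forever. Otherwise all steps
       go to parents, which are smaller numbers. *)
    destruct (classic (exists n, N <= n /\ child (r n) (r (S n)))) as [[n [Hn Hc]]|Hup].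
    - assert (Hdown : forall m, n <= m -> child (r m) (r (S m))).
      { intros m Hm. induction Hm as [|m Hm IH]; [easy|].
        destruct (Hstep (S m)) as [Hd|Hu]; [lia|easy|].
        destruct IH as [_ E1]. destruct Hu as [_ E2]. rewrite E1 in E2.
        apply Hinj in E2. lia. }
      assert (Hacc : forall x, Acc prec x -> forall m, n <= m -> r m <> x).
      { induction 1 as [x _ IH]. intros m Hm E.
        apply (IH (r (S m))) with (m := S m); [|lia|easy].
        rewrite <- E. apply (Hdown m Hm). }
      apply (Hacc (r n)) with (m := n); [|lia|easy]. apply prec_wf. apply HU. auto.
    - assert (Hdecr : forall k, r (N + k) + k <= r N).
      { induction k as [|k IH]; [rewrite !Nat.add_0_r; lia|].
        destruct (Hstep (N + k)) as [Hd|[[_ [_ [_ Hlt]]] _]]; [lia|exfalso; apply Hup; exists (N + k); split; [lia|easy]|].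
        rewrite !Nat.add_succ_r. lia. }
      specialize (Hdecr (S (r N))). lia. }
  destruct (Hher U (fun x Hx => Hx) b) as [c [Hc1 [Hc2 Hc3]]].
  exists c. intros v.
  destruct (classic (bounded (adj v))) as [Hv|Hv].
  - assert (HUv : U v) by (intros Hi; destruct (Hi Hv)).
    destruct (minimal_majority H H_sym _ c v (fun x Hx => adj_irrefl x (proj1 Hx)) Hc2
      (conj HUv (HF v Hv)) (HF v Hv)) as [g [Hg1 Hg2]].
    assert (HH : forall u, adj v u -> H v u) by (intros u Hu; split; [easy|tauto]).
    exists g. split.
    + intros u [Hu1 Hu2]. destruct (Hg1 u) as [[H1 _] H2]; auto.
    + intros u w [Hu1 Hu2] [Hw1 Hw2]. apply Hg2; auto.
  (* [H] is a subgraph, so happiness in [H] suffices for ranked [v]; an unranked [v] has infinitely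
     many unranked neighbours of the other colour under [b]. *)
  - apply injects_unbounded. destruct (classic (ranked v)) as [Hr|Hr].
    + assert (HUv : U v) by (intros _; easy).
      intros Hbd. apply (Hc3 v HUv (HI v HUv Hv)).
      apply (bounded_sub _ _ Hbd). intros u [[Hu1 _] Hu2]. easy.
    + intros Hbd. apply (Hb v (unranked_spec v Hv Hr)).
      apply (bounded_sub _ _ Hbd). intros u [[Hu1 [Hu2 Hu3]] Hu4]. split; [easy|].
      rewrite !Hc1; [easy| |]; unfold U; tauto.
Qed.

End Reduction.

(** * Transfer to arbitrary countable vertex sets *)

Lemma card_le_of_relation (V : Type) (A B : V -> Prop) (R : V -> V -> Prop) :
  (forall a, A a -> exists b, B b /\ R a b) ->
  (forall a a' b, A a -> A a' -> R a b -> R a' b -> a = a') ->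
  card_le A B.
Proof.
  intros Hex Hinj.
  destruct (functional_choice {x | A x} {y | B y} (fun a b => R (proj1_sig a) (proj1_sig b)))
    as [f Hf].
  { intros [a Ha]. destruct (Hex a Ha) as [b [Hb HR]]. exists (exist _ b Hb). easy. }
  exists f. intros a b E.
  pose proof (Hf a) as H1. pose proof (Hf b) as H2. rewrite E in H1.
  apply eq_sig_hprop; [intros; apply proof_irrelevance|].
  apply (Hinj _ _ _ (proj2_sig a) (proj2_sig b) H1 H2).
Qed.

Lemma finite_set_image (V : Type) (f : V -> nat) (A : V -> Prop) :
  (forall x y, f x = f y -> x = y) ->
  (finite_set A <-> bounded (fun n => exists v, A v /\ f v = n)).
Proof.
  intros Hf. split.
  - intros [l Hl]. exists (S (list_max (map f l))). intros n [v [Hv <-]].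
    assert (Hle : Forall (fun k => k <= list_max (map f l)) (map f l)) by (apply list_max_le; lia).
    rewrite Forall_forall in Hle. specialize (Hle (f v) (in_map f l v (Hl v Hv))). lia.
  - intros [N HN].
    assert (Hl : forall N, exists l : list V, forall v, f v < N -> In v l).
    { clear N HN. induction N as [|N [l Hl]]; [exists nil; lia|].
      destruct (classic (exists v, f v = N)) as [[v Hv]|Hn].
      - exists (v :: l). intros w Hw. destruct (Nat.eq_dec (f w) N) as [E|E].
        + left. apply Hf. congruence.
        + right. apply Hl. lia.
      - exists l. intros w Hw. apply Hl.
        assert (f w <> N) by (intros E; apply Hn; eauto). lia. }
    destruct (Hl N) as [l Hl']. exists l. intros v Hv. apply Hl'. eauto.
Qed.

Theorem theorem1 (V : Type) (G : simple_graph V) :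
  countable_type V ->
  (~ exists r : nat -> V, alternating_ray G r) ->
  exists c : V -> bool, unfriendly G c.
Proof.
  intros [f Hf] Hray.
  (* Numbers outside the range of [f] are isolated in [E], so every ray of [E] comes from [G]. *)
  set (E := fun m n => exists u v, f u = m /\ f v = n /\ adj G u v).
  assert (HE : forall u v, E (f u) (f v) <-> adj G u v).
  { intros u v. split.
    - intros [u' [v' [H1 [H2 H3]]]]. apply Hf in H1, H2. congruence.
    - intros H. exists u, v. easy. }
  assert (Hdeg : forall v, finite_degree G v <-> bounded (E (f v))).
  { intros v. unfold finite_degree. rewrite (finite_set_image V f) by easy.
    split; intros H; apply (bounded_sub _ _ H); intros n.
    - intros [u' [w [H1 [H2 H3]]]]. apply Hf in H1. subst u'. eauto.
    - intros [w [H1 <-]]. apply HE. easy. }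
  destruct (unfriendly_nat E) as [c Hc].
  - intros m n [u [v [H1 [H2 H3]]]]. exists v, u. split; [easy|]. split; [easy|].
    apply adj_sym. easy.
  - intros n [u [v [H1 [H2 H3]]]]. rewrite <- H2 in H1. apply Hf in H1. subst v.
    apply (adj_irrefl _ G u H3).
  - intros r Hinj Hadj Hfin Hinf. apply Hray.
    destruct (functional_choice nat V (fun n v => f v = r n)) as [s Hs].
    { intros n. destruct (Hadj n) as [u [v [H1 _]]]. eauto. }
    exists s. split; [split|split].
    + intros m n Hmn. apply Hinj. rewrite <- !Hs, Hmn. easy.
    + intros n. apply HE. rewrite !Hs. easy.
    + intros N. destruct (Hfin N) as [n [H1 H2]]. exists n. split; [easy|].
      apply Hdeg. rewrite Hs. easy.
    + intros N. destruct (Hinf N) as [n [H1 H2]]. exists n. split; [easy|].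
      rewrite Hdeg, Hs. easy.
  - exists (fun v => c (f v)). intros v. destruct (Hc (f v)) as [g [Hg1 Hg2]].
    apply (card_le_of_relation _ _ _ (fun u w => f w = g (f u))).
    + intros u [Hu1 Hu2]. destruct (Hg1 (f u)) as [H1 H2]; [rewrite HE; easy|].
      destruct H1 as [v' [w [_ [H3 H4]]]]. exists w. split; [|easy].
      destruct (Hg1 (f u)) as [H5 _]; [rewrite HE; easy|].
      rewrite <- H3 in H5, H2. apply HE in H5. easy.
    + intros u u' w [Hu1 Hu2] [Hu1' Hu2'] H1 H2. apply Hf. apply Hg2.
      * rewrite HE. easy.
      * rewrite HE. easy.
      * congruence.
Qed.
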